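(* Let $F$ be an algebraically closed field of characteristic $0$, let $n\ge2$, let $\mathrm{I}=\sqrt{-1}\in F$, and let $\mathfrak{J}$ be the anti-Jordan triple system of all $n\times n$ matrices over $F$. The following five maps are pairwise inequivalent irreducible representations of $\mathfrak{J}$, and every finite-dimensional irreducible representation of $\mathfrak{J}$ is equivalent to one of them: (1) the one-dimensional zero representation, $E_{i,j}\mapsto 0$ on $F$; (2), (3) for each sign $\varepsilon\in\{1,-1\}$, the representation on $F^n$ given by $E_{1,1}\mapsto\varepsilon E_{1,1}$; $E_{i,j}\mapsto\varepsilon E_{i,j}$ for $i,j\ne1$; $E_{1,i}\mapsto\tfrac12\varepsilon E_{1,i}$ and $E_{i,1}\mapsto2\varepsilon E_{i,1}$ for $i\ne1$; (4), (5) for each sign $\varepsilon\in\{1,-1\}$, the representation on $F^n$ given by $E_{i,j}\mapsto-\varepsilon\,\mathrm{I}\,E_{j,i}$ for all $i,j\in\{1,\dots,n\}$.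
   Context: $\mathfrak{J}$ is the space of $n\times n$ matrices over $F$ with trilinear product $\langle a,b,c\rangle=abc-cba$; $E_{i,j}$ ($1\le i,j\le n$) are the matrix units. A representation of $\mathfrak{J}$ on a vector space $V$ is a linear map $\rho:\mathfrak{J}\to\mathrm{End}\,V$ with $\rho(\langle a,b,c\rangle)=\rho(a)\rho(b)\rho(c)-\rho(c)\rho(b)\rho(a)$ for all $a,b,c\in\mathfrak{J}$. It is irreducible if $V\ne0$ and $V$ has no subspace other than $0$ and $V$ invariant under all $\rho(a)$. Two representations $\rho_1,\rho_2$ are equivalent if there is an invertible linear map $T$ between the underlying spaces with $\rho_2(a)=T^{-1}\rho_1(a)T$ for all $a\in\mathfrak{J}$. *)

(* Defs.v *)
From HB Require Import structures.
From mathcomp Require Import all_boot all_algebra.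

Set Implicit Arguments.
Unset Strict Implicit.
Unset Printing Implicit Defensive.

Import GRing.Theory.
Local Open Scope ring_scope.

Section TripleSystem.

Variables (F : fieldType) (n : nat).

Definition triple (a b c : 'M[F]_n) : 'M[F]_n := a *m b *m c - c *m b *m a.

(* A [vectType] is finite-dimensional, so every space below is. *)
Definition is_representation (V : vectType F) (rho : 'M[F]_n -> 'End(V)) :=
  linear rho /\
  forall a b c : 'M[F]_n,
    rho (triple a b c)
      = (rho a \o rho b \o rho c)%VF - (rho c \o rho b \o rho a)%VF.

Definition irreducible (V : vectType F) (rho : 'M[F]_n -> 'End(V)) :=
  fullv <> 0%VS :> {vspace V} /\
  forall U : {vspace V},
    (forall a : 'M[F]_n, (rho a @: U <= U)%VS) -> U = 0%VS \/ U = fullv.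

(* [S] is the inverse of [T]. *)
Definition equivalent (V1 V2 : vectType F)
    (rho1 : 'M[F]_n -> 'End(V1)) (rho2 : 'M[F]_n -> 'End(V2)) :=
  exists (T : 'Hom(V2, V1)) (S : 'Hom(V1, V2)),
    [/\ (S \o T)%VF = \1%VF, (T \o S)%VF = \1%VF
      & forall a : 'M[F]_n, rho2 a = (S \o rho1 a \o T)%VF].

(* A map into the endomorphisms of some space, with no condition on it. *)
Record endo_map := EndoMap {
  carrier : vectType F;
  action : 'M[F]_n -> 'End(carrier) }.

(* F^n is the space of column vectors, on which matrices act on the left. *)
Definition mx_endo (A : 'M[F]_n) : 'End('cV[F]_n) :=
  linfun (mulmx A : 'cV[F]_n -> 'cV[F]_n).

(* The linear map sending the matrix unit E_{i,j} to [img i j]. *)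
Definition on_units (img : 'I_n -> 'I_n -> 'M[F]_n) : endo_map :=
  @EndoMap 'cV[F]_n
    (fun a => mx_endo (\sum_(i < n) \sum_(j < n) a i j *: img i j)).

Definition zero_map : endo_map := @EndoMap F^o (fun=> 0).

(* Indices are shifted: the index 1 of E_{1,i} is the ordinal of value 0. *)
Definition std_coef (eps : F) (i j : 'I_n) : F :=
  match i == 0%N :> nat, j == 0%N :> nat with
  | true, true => eps
  | false, false => eps
  | true, false => 2%:R^-1 * eps
  | false, true => 2%:R * eps
  end.

Definition std_map (eps : F) : endo_map :=
  on_units (fun i j => std_coef eps i j *: delta_mx i j).

Definition tr_map (I eps : F) : endo_map :=
  on_units (fun i j => (- eps * I) *: delta_mx j i).

Inductive five := Zero | StdPlus | StdMinus | TrPlus | TrMinus.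

Definition five_maps (I : F) (k : five) : endo_map :=
  match k with
  | Zero => zero_map
  | StdPlus => std_map 1
  | StdMinus => std_map (-1)
  | TrPlus => tr_map I 1
  | TrMinus => tr_map I (-1)
  end.

End TripleSystem.

(* Main.v *)
Require Import Defs.
From HB Require Import structures.
From mathcomp Require Import all_boot all_algebra ring.

Set Implicit Arguments.
Unset Strict Implicit.
Unset Printing Implicit Defensive.

Import GRing.Theory.
Local Open Scope ring_scope.

(** Let rho be an irreducible representation and u = rho 1. The triple law with
    a = 1 reads rho [b, c] = u rho(b) rho(c) - rho(c) rho(b) u, and with
    a = b = 1 it says that u^2 commutes with the image of rho. Together they make
    u commute with rho of every commutator; commutators and 1 span the matrices
    in characteristic 0, so u commutes with the image of rho ([rho1_central])
    and, by Schur's lemma, is a scalar mu ([schur_scalar]).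

    If mu = 0, then rho kills 1 and all commutators, hence everything
    ([rho_eq0]), and irreducibility leaves the one-dimensional zero map.

    If mu is nonzero, r = rho / mu satisfies r 1 = 1 and
    k r(abc - cba) = r(a) r(b) r(c) - r(c) r(b) r(a) with k = mu^-2. Writing
    e_ij = r(E_ij), instances of this law on matrix units give, for i <> j, that
    e_ii = (e_ii - e_jj) e_ii, so that the e_ii are orthogonal idempotents
    ([diag_orthogonal], [diag_idem]); comparing this with
    2 e_ij e_ii = (1 - k) e_ij forces k = 1 or k = -1 ([normalized_parameter]).
    When k = 1 the e_ij multiply like matrix units, so r is a homomorphism of
    unital algebras ([normalized_multiplicative]). Composing r with
    transposition changes the sign of k, so when k = -1 the map a |-> r(a^T) is
    such a homomorphism. Hence rho(a) = mu R(a) with mu^2 = 1, or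
    rho(a) = mu R(a^T) with mu^2 = -1, for an algebra homomorphism R
    ([scalar_rep_cases]).

    Given R, a vector w with R(E_kk) w <> 0 yields the nonzero intertwiner
    v |-> R(v e_k^T) w from the column space, which is an isomorphism because
    both sides are irreducible ([schur_equivalent]). Four of the five maps have
    the form a |-> c P a P^-1 or c P a^T P^-1 ([std_map_form], [tr_map_form]),
    which yields that they are irreducible representations and identifies them
    with the cases above. They are inequivalent because 1 acts on the five
    spaces by the distinct scalars 0, 1, -1, -I, I ([five_scalar_inj]). *)

(** * Matrix units and characteristic zero *)

Lemma natf_neq0_char0 (F : fieldType) (charF : [pchar F] =i pred0) (m : nat) :
  m.+1%:R != 0 :> F.
Proof. by move/pcharf0P: charF => ->. Qed.

Lemma addrr_eq0_char0 (F : fieldType) (V : lmodType F)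
  (charF : [pchar F] =i pred0) (x : V) : x + x = 0 -> x = 0.
Proof.
rewrite -mulr2n -scaler_nat => /eqP; rewrite scaler_eq0.
by rewrite (negbTE (natf_neq0_char0 charF 1)) => /eqP.
Qed.

Lemma delta_mulE (F : fieldType) (n : nat) (i j k l : 'I_n) :
  delta_mx i j *m delta_mx k l = (j == k)%:R *: delta_mx i l :> 'M[F]_n.
Proof.
case: eqP => [->|/eqP jk]; first by rewrite mul_delta_mx scale1r.
by rewrite mul_delta_mx_0 // scale0r.
Qed.

(** * The image of the identity *)

(** Off-diagonal units are commutators, and so are the differences of diagonal
    units; hence [n *: E_ii] is [1] plus a sum of commutators. *)
Lemma vanish_on_commutators (F : fieldType) (n : nat) (W : lmodType F)
  (charF : [pchar F] =i pred0) (n_gt0 : (0 < n)%N) (f : {linear 'M[F]_n -> W}) :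
  f 1%:M = 0 -> (forall b c, f (b *m c - c *m b) = 0) -> forall a, f a = 0.
Proof.
move=> f1 fcomm.
have n_neq0 : n%:R != 0 :> F.
  by rewrite -(prednK n_gt0); exact: natf_neq0_char0.
have off i j : i != j -> f (delta_mx i j) = 0.
  move=> ij; have := fcomm (delta_mx i i) (delta_mx i j).
  by rewrite !delta_mulE eqxx eq_sym (negbTE ij) scale1r scale0r subr0.
have diff i j : f (delta_mx i i) = f (delta_mx j j).
  apply/eqP; rewrite -subr_eq0 -linearB.
  have := fcomm (delta_mx i j) (delta_mx j i).
  by rewrite !delta_mulE !eqxx !scale1r => ->.
have diag i : f (delta_mx i i) = 0.
  apply: (scalerI n_neq0); rewrite scaler0 -f1 mx1_sum_delta linear_sum.
  by rewrite (eq_bigr _ (fun j _ => diff j i)) sumr_const card_ord scaler_nat.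
move=> a; rewrite (matrix_sum_delta a) linear_sum big1 // => i _.
rewrite linear_sum big1 // => j _; rewrite linearZ /=.
by case: (eqVneq i j) => [<-|/off->]; rewrite ?diag scaler0.
Qed.

(** Put [u := rho 1]. The law at [(1, b, c)] expresses [rho [b, c]] through [u],
    and exchanging [b] and [c] gives a second expression. Multiplying one by [u]
    on the left and the other by [u] on the right gives the same element because
    [u ^+ 2] commutes with the image of [rho], by the law at [(1, 1, c)]. *)
Lemma rho1_central (F : fieldType) (n : nat) (A : algType F)
  (rho : {linear 'M[F]_n -> A}) (charF : [pchar F] =i pred0) (n_gt0 : (0 < n)%N)
  (rhoP : forall a b c : 'M[F]_n,
     rho (triple a b c) = rho a * rho b * rho c - rho c * rho b * rho a)
  (a : 'M[F]_n) : rho 1%:M * rho a = rho a * rho 1%:M.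
Proof.
set u := rho 1%:M.
have sq x : u * u * rho x = rho x * u * u.
  apply/eqP; rewrite -subr_eq0 -rhoP /triple !mul1mx !mulmx1.
  by rewrite subrr linear0.
have comm x y : rho (x *m y - y *m x) = u * rho x * rho y - rho y * rho x * u.
  by rewrite -rhoP /triple !mul1mx !mulmx1.
apply/eqP; rewrite -subr_eq0; apply/eqP.
apply: (vanish_on_commutators (f := (u \*o rho) \- (u \o* rho)) charF n_gt0).
  by rewrite /= subrr.
move=> b c /=; apply/eqP; rewrite subr_eq0; apply/eqP.
rewrite {1}comm -[b *m c - _]opprB linearN comm opprB mulrBr mulrBl !mulrA.
congr (_ - _).
by rewrite sq -!mulrA; congr (_ * _); rewrite !mulrA sq.
Qed.

Lemma rho_eq0 (F : fieldType) (n : nat) (A : algType F)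
  (rho : {linear 'M[F]_n -> A}) (charF : [pchar F] =i pred0) (n_gt0 : (0 < n)%N)
  (rhoP : forall a b c : 'M[F]_n,
     rho (triple a b c) = rho a * rho b * rho c - rho c * rho b * rho a) :
  rho 1%:M = 0 -> forall a, rho a = 0.
Proof.
move=> rho1; apply: (vanish_on_commutators charF n_gt0) => // b c.
have := rhoP 1%:M b c; rewrite /triple !mul1mx !mulmx1 rho1.
by rewrite !mul0r mulr0 subr0.
Qed.

(** * Representations sending the identity to one *)

Section Normalized.

Variables (F : fieldType) (n : nat) (A : algType F).
Hypothesis charF : [pchar F] =i pred0.
Hypothesis n_ge2 : (2 <= n)%N.

(** What remains of a representation taking the nonzero scalar value [mu] at [1]
    after division by [mu]; then [k = mu ^- 2]. *)
Definition normalized_rep (k : F) (r : 'M[F]_n -> A) :=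
  r 1%:M = 1 /\ forall a b c : 'M[F]_n,
    k *: r (triple a b c) = r a * r b * r c - r c * r b * r a.

(** Transposition reverses products: the transpose of [abc - cba] is the opposite
    of the triple product of the transposes. *)
Lemma normalized_rep_trmx (k : F) (r : 'M[F]_n -> A) :
  normalized_rep k r -> normalized_rep (- k) (r \o trmx).
Proof.
move=> [r1 rP]; split=> [|a b c] /=; first by rewrite trmx1.
by rewrite -[RHS]opprB -rP scaleNr /triple linearB /= !trmx_mul -!mulmxA.
Qed.

Variables (k : F) (r : {linear 'M[F]_n -> A}).
Hypothesis k_neq0 : k != 0.
Hypothesis r_rep : normalized_rep k r.

Local Notation e i j := (r (delta_mx i j)).

(** The law with one argument equal to [1]: up to the factor [k], [r] is a
    homomorphism of Lie algebras. *)
Lemma normalized_commutator (b c : 'M[F]_n) :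
  r b * r c - r c * r b = k *: r (b *m c - c *m b).
Proof.
have [r1 rP] := r_rep; have := rP 1%:M b c.
by rewrite /triple r1 !mul1mx !mulmx1 mul1r mulr1.
Qed.

Lemma diag_mul_unit (i j : 'I_n) : i != j ->
  e i i * e i j = e i j * e i i + k *: e i j.
Proof.
move=> ij; have ji : (j == i) = false by rewrite eq_sym (negbTE ij).
apply/eqP; rewrite addrC -subr_eq normalized_commutator.
by rewrite !(delta_mulE, eqxx, ji, scale1r, scale0r, subr0).
Qed.

Lemma diag_mul_unit_col (i j : 'I_n) : i != j ->
  e j j * e i j = e i j * e j j - k *: e i j.
Proof.
move=> ij; have ji : (j == i) = false by rewrite eq_sym (negbTE ij).
apply/eqP; rewrite addrC -subr_eq normalized_commutator.
by rewrite !(delta_mulE, eqxx, ji, scale1r, scale0r, sub0r) linearN scalerN.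
Qed.

(** The law at [(E_ii, E_ii, E_ij)], in which [e_ii] is moved to the right of
    [e_ij]. *)
Lemma unit_mul_diag_row (i j : 'I_n) : i != j ->
  e i j * e i i + e i j * e i i = (1 - k) *: e i j.
Proof.
move=> ij; have [_ rP] := r_rep.
have ji : (j == i) = false by rewrite eq_sym (negbTE ij).
have := rP (delta_mx i i) (delta_mx i i) (delta_mx i j).
rewrite /triple !(delta_mulE, eqxx, ji, scale0r, scale1r, mul0mx, subr0).
rewrite -mulrA (diag_mul_unit ij) mulrDr mulrA (diag_mul_unit ij).
rewrite -scalerAr (diag_mul_unit ij) mulrDl -scalerAl addrC !addrA addNr add0r.
rewrite -scalerDr => /(scalerI k_neq0) eq_e.
by rewrite scalerBl scale1r {3}eq_e addrA addrK.
Qed.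

(** The law at [(E_ij, E_ji, E_ii)]: [e_ii] commutes with [e_ji e_ij], so the
    right-hand side is the commutator of [e_ij] and [e_ji] times [e_ii]. *)
Lemma diag_shift (i j : 'I_n) : i != j -> e i i = (e i i - e j j) * e i i.
Proof.
move=> ij; have [_ rP] := r_rep.
have ij0 := negbTE ij; have ji0 : (j == i) = false by rewrite eq_sym.
have ji : j != i by rewrite eq_sym.
have := rP (delta_mx i j) (delta_mx j i) (delta_mx i i).
rewrite /triple !(delta_mulE, eqxx, ij0, ji0, scale0r, scale1r, mul0mx, subr0).
rewrite (diag_mul_unit_col ji) mulrBl -[_ * e i i * e i j]mulrA.
rewrite (diag_mul_unit ij) mulrDr.
rewrite -scalerAr -scalerAl addrK mulrA -mulrBl normalized_commutator.
rewrite !delta_mulE !eqxx !scale1r -scalerAl linearB.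
by move=> /(scalerI k_neq0).
Qed.

Lemma diag_comm (i j : 'I_n) : e i i * e j j = e j j * e i i.
Proof.
apply/eqP; rewrite -subr_eq0 normalized_commutator !delta_mulE.
by case: (eqVneq i j) => [->|_]; rewrite ?scale0r subrr linear0 scaler0.
Qed.

(** By [diag_shift] for [(i, j)] and for [(j, i)], the product [e_ii e_jj] equals
    both an element and its opposite. *)
Lemma diag_orthogonal (i j : 'I_n) : i != j -> e i i * e j j = 0.
Proof.
move=> ij; have ji : j != i by rewrite eq_sym.
have eq1 : e i i * e j j = e i i * (e i i * e j j) - e j j * (e i i * e j j).
  by rewrite [in LHS](diag_shift ij) !mulrBl !mulrA.
have eq2 : e i i * e j j = e j j * (e i i * e j j) - e i i * (e i i * e j j).
  rewrite [LHS]diag_comm [in LHS](diag_shift ji) !mulrBl -!mulrA.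
  by rewrite -(diag_comm i j).
apply: (addrr_eq0_char0 charF).
by rewrite [X in X + _]eq1 [X in _ + X]eq2 addrA subrK subrr.
Qed.

Lemma exists_other_index (i : 'I_n) : exists j : 'I_n, i != j.
Proof.
have [i0|i_neq0] := eqVneq (i : nat) 0%N.
  by exists (Ordinal n_ge2); apply/eqP => /(congr1 val) /=; rewrite i0.
by exists (Ordinal (ltnW n_ge2)); apply: contra_neq i_neq0 => ->.
Qed.

Lemma diag_idem (i : 'I_n) : e i i * e i i = e i i.
Proof.
have [j ij] := exists_other_index i.
rewrite [RHS](diag_shift ij) mulrBl -(diag_comm i j) (diag_orthogonal ij).
by rewrite subr0.
Qed.

Lemma unit_mul_diag_row0 (i j : 'I_n) : i != j ->
  (1 + k) *: (e i j * e i i) = 0.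
Proof.
move=> ij; have := congr1 ( *%R^~ (e i i)) (unit_mul_diag_row ij).
rewrite /= mulrDl -!mulrA diag_idem -scalerAl scalerBl scale1r.
by move=> /addrI eq_x; rewrite scalerDl scale1r {1}eq_x addNr.
Qed.

(** If [k] is neither [1] nor [-1], then [e_ij e_ii = 0] by
    [unit_mul_diag_row0], so [e_ij = 0] by [unit_mul_diag_row]. By
    [normalized_commutator] all [e_ii] then coincide, so they vanish by
    [diag_shift], although their sum is [r 1 = 1]. *)
Lemma normalized_parameter : k = 1 \/ k = -1.
Proof.
have [->|k_neq1] := eqVneq k 1; first by left.
have [->|k_neqN1] := eqVneq k (-1); first by right.
have row0 i j : i != j -> e i j = 0.
  move=> ij; have := unit_mul_diag_row0 ij => /eqP.
  rewrite scaler_eq0 addrC addr_eq0 (negbTE k_neqN1) => /eqP eh0.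
  have := unit_mul_diag_row ij; rewrite eh0 addr0 => /esym/eqP.
  by rewrite scaler_eq0 subr_eq0 eq_sym (negbTE k_neq1) => /eqP.
have diag0 i : e i i = 0.
  have [j ij] := exists_other_index i.
  have := normalized_commutator (delta_mx i j) (delta_mx j i).
  rewrite (row0 _ _ ij) mul0r mulr0 subr0 !delta_mulE !eqxx !scale1r linearB.
  move=> /esym/eqP; rewrite scaler_eq0 (negbTE k_neq0) => /eqP h0.
  by rewrite (diag_shift ij) h0 mul0r.
have := oner_neq0 A; have [<- _] := r_rep.
by rewrite mx1_sum_delta linear_sum big1 ?eqxx.
Qed.

Hypothesis k1 : k = 1.

Lemma diag_mul_row (i j : 'I_n) : e i i * e i j = e i j.
Proof.
case: (eqVneq i j) => [<-|ij]; first exact: diag_idem.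
suff eh0 : e i j * e i i = 0 by rewrite (diag_mul_unit ij) eh0 k1 scale1r add0r.
apply: (addrr_eq0_char0 charF); have := unit_mul_diag_row0 ij.
by rewrite k1 scalerDl scale1r.
Qed.

Lemma col_mul_diag (i j : 'I_n) : e i j * e j j = e i j.
Proof.
case: (eqVneq i j) => [<-|ij]; first exact: diag_idem.
have ji : j != i by rewrite eq_sym.
have := diag_mul_unit_col ij.
rewrite -{1}(diag_mul_row i j) mulrA (diag_orthogonal ji) mul0r k1 scale1r.
by move=> /esym/eqP; rewrite subr_eq0 => /eqP.
Qed.

(** Orthogonality of the [e_ii] kills the products with [j != l]. When [j = l],
    the commutator of [E_ij] and [E_jm] suffices: the product in the other order
    vanishes if [i != m], and is removed by multiplying by [e_ii] on the left if
    [i = m]. *)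
Lemma unit_mul_unit (i j l m : 'I_n) : e i j * e l m = (j == l)%:R *: e i m.
Proof.
have orth a b c d : b != c -> e a b * e c d = 0.
  move=> bc; rewrite -(col_mul_diag a b) -(diag_mul_row c d) mulrA.
  by rewrite -(mulrA (e a b)) (diag_orthogonal bc) mulr0 mul0r.
case: (eqVneq j l) => [<-|jl]; last by rewrite orth // scale0r.
rewrite scale1r; case: (eqVneq m i) => [->|mi]; last first.
  have := normalized_commutator (delta_mx i j) (delta_mx j m).
  rewrite (orth _ _ _ _ mi) subr0 !delta_mulE eqxx (negbTE mi).
  by rewrite k1 scale0r subr0 !scale1r.
case: (eqVneq i j) => [<-|ij]; first exact: diag_idem.
have := normalized_commutator (delta_mx i j) (delta_mx j i).
rewrite !delta_mulE !eqxx !scale1r k1 scale1r linearB.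
move=> /(congr1 ( *%R (e i i))).
rewrite /= !mulrBr !mulrA diag_mul_row diag_idem (orth _ _ _ _ ij).
by rewrite (orth _ _ _ _ ij) mul0r !subr0.
Qed.

Lemma normalized_multiplicative (a b : 'M[F]_n) : r (a *m b) = r a * r b.
Proof.
have delta i j : r (delta_mx i j *m b) = e i j * r b.
  rewrite (matrix_sum_delta b) mulmx_sumr !linear_sum mulr_sumr /=.
  apply: eq_bigr => l _; rewrite mulmx_sumr !linear_sum mulr_sumr /=.
  apply: eq_bigr => m _; rewrite -scalemxAr !linearZ /= delta_mulE linearZ /=.
  by rewrite -unit_mul_unit scalerAr.
rewrite {1}(matrix_sum_delta a) [in RHS](matrix_sum_delta a).
rewrite mulmx_suml !linear_sum mulr_suml /=; apply: eq_bigr => i _.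
rewrite mulmx_suml !linear_sum mulr_suml /=; apply: eq_bigr => j _.
by rewrite -scalemxAl !linearZ /= delta scalerAl.
Qed.

End Normalized.

(** With [k = mu ^- 2], the values [1] and [-1] of [k] are those of [mu ^+ 2]. *)
Lemma scalar_rep_cases (F : fieldType) (n : nat) (A : algType F)
  (rho : {linear 'M[F]_n -> A}) (mu : F)
  (charF : [pchar F] =i pred0) (n_ge2 : (2 <= n)%N)
  (rhoP : forall a b c : 'M[F]_n,
     rho (triple a b c) = rho a * rho b * rho c - rho c * rho b * rho a) :
  mu != 0 -> rho 1%:M = mu%:A ->
  exists R : {linear 'M[F]_n -> A},
    [/\ R 1%:M = 1, forall a b, R (a *m b) = R a * R b &
      mu ^+ 2 = 1 /\ (forall a, rho a = mu *: R a) \/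
      mu ^+ 2 = -1 /\ (forall a, rho a = mu *: R a^T)].
Proof.
move=> mu_neq0 rho1; pose k := mu ^- 2.
have k_neq0 : k != 0 by rewrite invr_eq0 expf_neq0.
pose r : {linear 'M[F]_n -> A} := mu^-1 \*: rho.
have rhoE a : rho a = mu *: r a by rewrite /r /= scalerA mulfV // scale1r.
have r_rep : normalized_rep k r.
  split=> [|a b c]; first by rewrite /r /= rho1 scalerA mulVf // scale1r.
  have cube (x y z : A) :
    mu ^+ 3 *: (x * y * z) = (mu *: x) * (mu *: y) * (mu *: z).
    by rewrite -!scalerAl -!scalerAr -!scalerAl !scalerA -expr2 -exprSr.
  have mu3k : mu ^+ 3 * k = mu.
    by rewrite /k exprSr mulrAC mulfV ?expf_neq0 // mul1r.
  apply: (scalerI (expf_neq0 3 mu_neq0)).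
  rewrite scalerA mu3k -rhoE rhoP scalerBr.
  by rewrite !(cube (r _)) -!rhoE.
have [k1|kN1] := normalized_parameter charF n_ge2 k_neq0 r_rep.
  exists r; split; [by case: r_rep | | left].
    by move=> a b; rewrite (normalized_multiplicative charF n_ge2 k_neq0 r_rep).
  by split=> //; apply: invr_inj; rewrite invr1.
have rT_rep := normalized_rep_trmx r_rep.
exists (r \o trmx); split; [by case: rT_rep | | right].
  apply: (normalized_multiplicative charF n_ge2 _ rT_rep).
    by rewrite oppr_eq0.
  by rewrite kN1 opprK.
split=> [|a]; last by rewrite /= trmxK.
by apply: invr_inj; rewrite invrN1.
Qed.

(** * Schur's lemma *)

(** On a nonzero space, the algebra of endomorphisms whose product is the
    composition in the usual order, [f * g = f \o g]; [lfun_algType] has the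
    opposite product. *)
Section EndAlgebra.

Variables (F : fieldType) (V : vectType F).
Hypothesis V_proper : (0 < dim V)%N.

Definition end_nzRingType : nzRingType :=
  HB.pack 'End(V) (lfun_comp_nzRingMixin V_proper).
Definition end_lalgType : lalgType F :=
  HB.pack 'End(V) end_nzRingType
    (GRing.Lmodule_isLalgebra.Build F end_nzRingType
       (fun k f g => comp_lfunZl k f g)).
Definition end_algType : algType F :=
  HB.pack 'End(V) end_lalgType
    (GRing.Lalgebra_isAlgebra.Build F end_lalgType
       (fun k f g => comp_lfunZr k f g)).

End EndAlgebra.

Lemma dim_gt0 (F : fieldType) (V : vectType F) :
  fullv <> 0%VS :> {vspace V} -> (0 < dim V)%N.
Proof. by move/eqP; rewrite -dimv_eq0 dimvf lt0n. Qed.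

Lemma sub_scalar_lfunE (F : fieldType) (V : vectType F) (f : 'End(V)) mu v :
  (f - mu *: \1%VF) v = f v - mu *: v.
Proof. by rewrite add_lfunE opp_lfunE scale_lfunE id_lfunE. Qed.

Section Eigenvalue.

Import VectorInternalTheory.

Lemma exists_eigenvalue (F : closedFieldType) (V : vectType F) (f : 'End(V)) :
  (0 < dim V)%N -> exists mu, lker (f - mu *: \1%VF) != 0%VS.
Proof.
move=> V_proper.
have /closed_rootP[mu] : size (char_poly (lin1_mx (v2r \o f \o r2v))) != 1%N.
  by rewrite size_char_poly; case: (dim V) V_proper.
rewrite -eigenvalue_root_char => /eigenvalueP[v fv v_neq0]; exists mu.
apply: contra v_neq0 => /eqP ker0; rewrite -(r2vK v) -(linear0 v2r).
rewrite (can_eq v2rK) -memv0 -ker0 memv_ker sub_scalar_lfunE.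
have fv' : v2r (f (r2v v)) = mu *: v by rewrite -fv mul_rV_lin1.
by rewrite subr_eq0 -(can_eq v2rK) fv' linearZ /= r2vK.
Qed.

End Eigenvalue.

(** An eigenspace of [f] is invariant and nonzero. *)
Lemma schur_scalar (F : closedFieldType) (n : nat) (V : vectType F)
  (rho : 'M[F]_n -> 'End(V)) (rho_irr : irreducible rho) (f : 'End(V)) :
  (forall a, (f \o rho a = rho a \o f)%VF) -> exists mu, f = mu *: \1%VF.
Proof.
move=> f_comm; have [V_neq0 rho_inv] := rho_irr.
have [mu ker_neq0] := exists_eigenvalue f (dim_gt0 V_neq0); exists mu.
case: (rho_inv (lker (f - mu *: \1%VF))) => [a|ker0|ker_full].
- apply/subvP => _ /memv_imgP[v + ->].
  rewrite !memv_ker !sub_scalar_lfunE !subr_eq0 => /eqP fv.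
  by rewrite -comp_lfunE f_comm comp_lfunE fv linearZ.
- by rewrite ker0 eqxx in ker_neq0.
apply/lfunP => v; have := memvf v; rewrite -ker_full memv_ker sub_scalar_lfunE.
by rewrite subr_eq0 scale_lfunE id_lfunE => /eqP.
Qed.

(** The kernel and the image of an intertwiner are invariant. *)
Lemma schur_equivalent (F : fieldType) (n : nat) (V1 V2 : vectType F)
  (rho1 : 'M[F]_n -> 'End(V1)) (rho2 : 'M[F]_n -> 'End(V2)) (T : 'Hom(V2, V1)) :
  irreducible rho1 -> irreducible rho2 -> T != 0 ->
  (forall a v, T (rho2 a v) = rho1 a (T v)) -> equivalent rho1 rho2.
Proof.
move=> [_ irr1] [_ irr2] T_neq0 T_rho.
have ker0 : lker T == 0%VS.
  case: (irr2 (lker T)) => [a|->//|ker_full].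
    apply/subvP => _ /memv_imgP[v + ->]; rewrite !memv_ker T_rho => /eqP->.
    by rewrite linear0.
  case/eqP: T_neq0; apply/lfunP => v; rewrite lfunE /=; apply/eqP.
  by rewrite -memv_ker ker_full memvf.
have img_full : limg T = fullv.
  case: (irr1 (limg T)) => [a|img0|//].
    apply/subvP => _ /memv_imgP[_ /memv_imgP[v _ ->] ->].
    by rewrite -T_rho memv_img ?memvf.
  case/eqP: T_neq0; apply/lfunP => v; rewrite lfunE /=; apply/eqP.
  by rewrite -memv0 -img0 memv_img ?memvf.
have TK : (T \o T^-1 = \1)%VF.
  apply/lfunP => v; have : v \in limg T by rewrite img_full memvf.
  case/memv_imgP => w _ ->.
  by rewrite !lfunE /= lker0_lfunK.
exists T, (T^-1)%VF; split=> [||a]; [exact: lker0_compVf | exact: TK |].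
apply/lfunP => v; rewrite !lfunE /= !lfunE /= -T_rho.
by rewrite lker0_lfunK.
Qed.

(** * Matrix representations conjugate to the identity or the transpose *)

Lemma mx_endoE (F : fieldType) (n : nat) (A : 'M[F]_n) (v : 'cV_n) :
  mx_endo A v = A *m v.
Proof. by rewrite lfunE. Qed.

Definition opt_trmx (F : fieldType) (n : nat) (t : bool) (a : 'M[F]_n) :=
  if t then a^T else a.

(** The common shape of the four nonzero maps; [Q] is the inverse of [P]. *)
Definition conj_form (F : fieldType) (n : nat) (t : bool) (c : F)
    (rho : 'M[F]_n -> 'End('cV[F]_n)) :=
  exists P Q : 'M[F]_n,
    P *m Q = 1%:M /\
    forall a, rho a = mx_endo (c *: (P *m opt_trmx t a *m Q)).

Section ConjForm.

Variables (F : fieldType) (n : nat) (t : bool) (c : F).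
Variable rho : 'M[F]_n -> 'End('cV[F]_n).
Hypothesis rho_form : conj_form t c rho.

(** Transposition contributes the sign that [c ^+ 2 = -1] compensates. *)
Lemma conj_form_representation :
  c ^+ 2 = (if t then -1 else 1) -> is_representation rho.
Proof.
move=> c2; have [P [Q [PQ rhoE]]] := rho_form.
have QP : Q *m P = 1%:M by rewrite mulmx1C.
split=> [k a b|x y z]; apply/lfunP => v; rewrite !lfunE /= !lfunE /= !rhoE.
  rewrite !mx_endoE /opt_trmx.
  have -> : (if t then (k *: a + b)^T else k *: a + b)
          = k *: (if t then a^T else a) + (if t then b^T else b).
    by case: t; rewrite // linearP.
  rewrite mulmxDr mulmxDl scalerDr mulmxDl -scalemxAr -!scalemxAl.
  by rewrite scalerA mulrC -scalerA.
rewrite !lfunE /= !lfunE /= !mx_endoE.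
have cube (p q s : 'M[F]_n) :
  (c *: (P *m p *m Q)) *m ((c *: (P *m q *m Q)) *m ((c *: (P *m s *m Q)) *m v))
  = (c ^+ 3 *: (P *m (p *m q *m s) *m Q)) *m v.
  rewrite -!scalemxAl -!scalemxAr !scalerA -expr2 -exprS !mulmxA.
  by rewrite -(mulmxA _ Q P) QP mulmx1 -(mulmxA _ Q P) QP mulmx1.
rewrite !cube exprSr c2 -mulmxBl; congr (_ *m _).
rewrite -scalerBr -mulmxBl -mulmxBr /triple /opt_trmx.
case: (t); rewrite ?mul1r // mulN1r scaleNr -scalerN; congr (_ *: _).
by rewrite linearB /= !trmx_mul !mulmxA -[in LHS]opprB mulmxN mulNmx.
Qed.

(** The operators [rho a] are all the endomorphisms of the column space. *)
Lemma conj_form_irreducible : (0 < n)%N -> c != 0 -> irreducible rho.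
Proof.
move=> n_gt0 c_neq0; have [P [Q [PQ rhoE]]] := rho_form.
have act_onto (B : 'M[F]_n) : exists a, rho a = mx_endo B.
  exists (opt_trmx t (Q *m (c^-1 *: B) *m P)); rewrite rhoE; congr mx_endo.
  have -> : opt_trmx t (opt_trmx t (Q *m (c^-1 *: B) *m P))
          = Q *m (c^-1 *: B) *m P.
    by rewrite /opt_trmx; case: (t); rewrite ?trmxK.
  by rewrite !mulmxA PQ mul1mx -mulmxA PQ mulmx1 scalerA mulfV // scale1r.
split=> [full0|U U_inv].
  have : const_mx 1 \in (0%VS : {vspace 'cV[F]_n}) by rewrite -full0 memvf.
  rewrite memv0 => /eqP/matrixP/(_ (Ordinal n_gt0) 0); rewrite !mxE => /eqP.
  by rewrite oner_eq0.
have [->|U_neq0] := eqVneq U 0%VS; [by left | right].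
have v_neq0 : vpick U != 0 by rewrite vpick0.
have [[i z]] : exists ij, vpick U ij.1 ij.2 != 0.
  by apply/existsP; rewrite -negb_forall; apply: contra v_neq0 => /forallP v0;
     apply/eqP/matrixP => i j; rewrite mxE; apply/eqP/(v0 (i, j)).
rewrite ord1 /= => vi_neq0.
apply/vspaceP => w; rewrite memvf.
(* the matrix [w (e_i^T / v_i)] sends [v := vpick U] to [w] *)
have [a rho_a] := act_onto (w *m ((vpick U i 0)^-1 *: delta_mx 0 i)).
have -> : w = rho a (vpick U).
  rewrite rho_a mx_endoE -mulmxA -scalemxAl -rowE.
  by rewrite [row i _]mx11_scalar mxE scale_scalar_mx mulVf // mulmx1.
by apply: (subvP (U_inv a)); rewrite memv_img ?memv_pick.
Qed.

Lemma conj_form1 : rho 1%:M = c *: \1%VF.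
Proof.
have [P [Q [PQ rhoE]]] := rho_form; apply/lfunP => v.
rewrite rhoE mx_endoE scale_lfunE id_lfunE /opt_trmx.
by rewrite [if t then _ else _](_ : _ = 1%:M);
   [rewrite mulmx1 PQ -scalemxAl mul1mx | case: (t); rewrite ?trmx1].
Qed.

End ConjForm.

(** * The five maps *)

Lemma on_units_entries (F : fieldType) (n : nat) (a : 'M[F]_n)
  (img : 'I_n -> 'I_n -> F) :
  \sum_i \sum_j a i j *: (img i j *: delta_mx i j)
    = \matrix_(i, j) (a i j * img i j).
Proof.
rewrite [RHS]matrix_sum_delta; apply: eq_bigr => i _; apply: eq_bigr => j _.
by rewrite mxE scalerA.
Qed.

(** Conjugation by the diagonal matrix with entries [2, 1, ..., 1]. *)
Lemma std_map_form (F : fieldType) (n : nat) (eps : F) :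
  2%:R != 0 :> F -> conj_form false eps (action (std_map n eps)).
Proof.
move=> two_neq0; pose w (i : 'I_n) : F := if i == 0%N :> nat then 2%:R else 1.
have w_neq0 i : w i != 0 by rewrite /w; case: ifP; rewrite ?oner_neq0.
exists (diag_mx (\row_i (w i)^-1)), (diag_mx (\row_i w i)); split=> [|a].
  by rewrite mulmx_diag; apply/matrixP => i j; rewrite !mxE mulVf.
congr mx_endo; rewrite on_units_entries; apply/matrixP => i j.
rewrite mul_mx_diag mul_diag_mx !mxE /std_coef /w /opt_trmx.
by case: (i == 0%N :> nat); case: (j == 0%N :> nat); rewrite ?invr1; field.
Qed.

Lemma tr_map_form (F : fieldType) (n : nat) (I eps : F) :
  conj_form true (- eps * I) (action (tr_map n I eps)).
Proof.
exists 1%:M, 1%:M; split=> [|a]; first by rewrite mulmx1.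
congr mx_endo; rewrite mul1mx mulmx1 /opt_trmx.
rewrite [in RHS](matrix_sum_delta a) linear_sum scaler_sumr.
apply: eq_bigr => i _; rewrite linear_sum scaler_sumr; apply: eq_bigr => j _.
by rewrite [in RHS]linearZ /= trmx_delta !scalerA mulrC.
Qed.

Lemma zero_map_irreducible (F : fieldType) (n : nat) :
  irreducible (action (zero_map F n)).
Proof.
split=> [full0|U _].
  have : (1 : F^o) \in (0%VS : {vspace F^o}) by rewrite -full0 memvf.
  by rewrite memv0 oner_eq0.
have [->|U_neq0] := eqVneq U 0%VS; [by left | right].
have v_neq0 : vpick U != 0 by rewrite vpick0.
apply/vspaceP => w; rewrite memvf.
have -> : w = (w / vpick U : F) *: vpick U by rewrite /GRing.scale /= divfK.
by rewrite memvZ ?memv_pick.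
Qed.

Lemma zero_map_representation (F : fieldType) (n : nat) :
  is_representation (action (zero_map F n)).
Proof.
by split=> [k a b|a b c] /=; rewrite ?scaler0 ?addr0 // !comp_lfun0l subrr.
Qed.

(** A scalar operator is unchanged by conjugation. *)
Lemma equivalent_scalar (F : fieldType) (n : nat) (V1 V2 : vectType F)
  (rho1 : 'M[F]_n -> 'End(V1)) (rho2 : 'M[F]_n -> 'End(V2)) (c1 c2 : F) :
  irreducible rho2 -> rho1 1%:M = c1 *: \1%VF -> rho2 1%:M = c2 *: \1%VF ->
  equivalent rho1 rho2 -> c1 = c2.
Proof.
move=> [V2_neq0 _] rho1E rho2E [T [S [ST _ rhoE]]].
have := rhoE 1%:M; rewrite rho1E rho2E -comp_lfunZr comp_lfun1r -comp_lfunZl ST.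
move=> /eqP; rewrite -subr_eq0 -scalerBl scaler_eq0 subr_eq0.
by rewrite (negbTE (lfun1_neq0 (dim_gt0 V2_neq0))) orbF => /eqP.
Qed.

(** The scalar by which the identity matrix acts. *)
Definition five_scalar (F : fieldType) (I : F) (k : five) : F :=
  match k with
  | Zero => 0
  | StdPlus => 1
  | StdMinus => -1
  | TrPlus => - 1 * I
  | TrMinus => - (-1) * I
  end.

(** The squares [0, 1, -1] separate the zero, standard and transposed maps;
    within a pair the two values are opposite and nonzero. *)
Lemma five_scalar_inj (F : fieldType) (I : F) (charF : [pchar F] =i pred0) :
  I ^+ 2 = -1 -> injective (five_scalar I).
Proof.
move=> sqrI.
have eqN (x : F) : (x == - x) = (x == 0).
  apply/eqP/eqP => [xN|->]; last by rewrite oppr0.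
  by apply: (addrr_eq0_char0 (V := F^o) charF); rewrite {1}xN addNr.
have I_neq0 : I != 0.
  by apply: contra_eq_neq sqrI => ->; rewrite expr0n eq_sym oppr_eq0 oner_neq0.
have sq k : five_scalar I k ^+ 2 =
    match k with Zero => 0 | StdPlus | StdMinus => 1 | _ => -1 end.
  by case: k => /=; rewrite ?opprK ?mulN1r ?mul1r ?sqrrN ?expr1n ?expr0n.
have N11 : (1 == -1 :> F) = false by rewrite eqN oner_eq0.
have N01 : (0 == 1 :> F) = false by rewrite eq_sym oner_eq0.
have N0N1 : (0 == -1 :> F) = false by rewrite eq_sym oppr_eq0 oner_eq0.
have NII : (I == - I) = false by rewrite eqN (negbTE I_neq0).
have neqs := (N11, N01, N0N1, NII).
have neqs_sym := (etrans (eq_sym _ _) N11, etrans (eq_sym _ _) N01,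
                  etrans (eq_sym _ _) N0N1, etrans (eq_sym _ _) NII).
move=> k l ekl; have := congr1 (fun x => x ^+ 2) ekl; rewrite /= !sq; move: ekl.
by case: k; case: l => /= /eqP + /eqP;
  rewrite ?opprK ?mulN1r ?mul1r ?neqs ?neqs_sym.
Qed.

(** * Classification *)

Lemma zero_equivalent (F : fieldType) (n : nat) (V : vectType F)
  (rho : 'M[F]_n -> 'End(V)) :
  irreducible rho -> (forall a, rho a = 0) ->
  equivalent rho (action (zero_map F n)).
Proof.
move=> irr rho0; have [/eqP V_neq0 _] := irr.
pose v := vpick (fullv : {vspace V}).
have v_neq0 : v != 0 by rewrite vpick0.
have line_linear : linear (fun x : F^o => x *: v).
  by move=> a x y; rewrite scalerDl -scalerA.
pose line : {linear F^o -> V} :=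
  HB.pack (fun x : F^o => x *: v) (GRing.isLinear.Build _ _ _ _ _ line_linear).
apply: (schur_equivalent (T := linfun line)) => // [||a x].
- exact: zero_map_irreducible.
- apply: contra_neq v_neq0 => /lfunP/(_ 1).
  by rewrite !lfunE /= scale1r.
by rewrite rho0 !lfunE linear0.
Qed.

(** The intertwiner is [v |-> R (Q v e_k^T) w], where [R E_kk w != 0]. It is
    nonzero at [P e_k], and [R a] moves inside as the left factor [a] of the
    argument of [R]. *)
Lemma multiplicative_equivalent (F : fieldType) (n : nat) (t : bool) (c : F)
  (V : vectType F) (V_proper : (0 < dim V)%N)
  (rho : 'M[F]_n -> 'End(V)) (rho' : 'M[F]_n -> 'End('cV[F]_n))
  (R : {linear 'M[F]_n -> end_algType V_proper}) :
  R 1%:M = 1 -> (forall a b, R (a *m b) = R a * R b) ->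
  (forall a, rho a = c *: R (opt_trmx t a)) ->
  conj_form t c rho' -> irreducible rho -> irreducible rho' ->
  equivalent rho rho'.
Proof.
move=> R1 RM rhoE [P [Q [PQ rho'E]]] irr irr'.
have QP : Q *m P = 1%:M by rewrite mulmx1C.
pose w := vpick (fullv : {vspace V}).
have w_neq0 : w != 0 by rewrite vpick0; case: irr => /eqP.
have /existsP[k Rw_neq0] : [exists k, (R (delta_mx k k) : 'End(V)) w != 0].
  apply: contraNT w_neq0; rewrite negb_exists => /forallP Rw0.
  (* the [R E_kk] add up to [R 1 = 1] *)
  rewrite -[w]id_lfunE -[\1%VF]/(1 : end_algType V_proper) -R1 mx1_sum_delta.
  rewrite linear_sum.
  rewrite [X in X == _](_ : _ = \sum_k (R (delta_mx k k) : 'End(V)) w).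
    by rewrite big1 // => k _; apply/eqP/negbNE.
  exact: sum_lfunE.
pose Tf (v : 'cV[F]_n) : V := (R (Q *m v *m delta_mx 0 k) : 'End(V)) w.
have Tf_linear : linear Tf.
  move=> a u v; rewrite /Tf mulmxDr -scalemxAr mulmxDl -scalemxAl linearP.
  by rewrite lfunE /= lfunE.
pose Tl : {linear 'cV[F]_n -> V} :=
  HB.pack Tf (GRing.isLinear.Build _ _ _ _ Tf Tf_linear).
apply: (schur_equivalent (T := linfun Tl)) => // [|a v].
  apply: contra_neq Rw_neq0 => /lfunP/(_ (P *m delta_mx k 0)).
  by rewrite !lfunE /= /Tf !mulmxA QP mul1mx mul_delta_mx.
rewrite !lfunE /= /Tf rho'E rhoE mx_endoE.
have -> : Q *m (c *: (P *m opt_trmx t a *m Q) *m v) *m delta_mx 0 k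
        = c *: (opt_trmx t a *m (Q *m v *m delta_mx 0 k)).
  by rewrite -scalemxAl -scalemxAr -scalemxAl !mulmxA QP mul1mx.
by rewrite linearZ /= RM !scale_lfunE comp_lfunE.
Qed.

Theorem mainTheorem3 (F : closedFieldType) (n : nat) (I : F)
    (charF : [pchar F] =i pred0) (n_ge2 : (2 <= n)%N) (sqrI : I ^+ 2 = -1) :
  [/\ forall k : five,
        is_representation (action (five_maps n I k)) /\
        irreducible (action (five_maps n I k)),
      forall k l : five, k <> l ->
        ~ equivalent (action (five_maps n I k))
                     (action (five_maps n I l))
    & forall (V : vectType F) (rho : 'M[F]_n -> 'End(V)),
        is_representation rho -> irreducible rho ->
        exists k : five, equivalent rho (action (five_maps n I k))].
Proof.
have n_gt0 : (0 < n)%N := ltnW n_ge2.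
have two_neq0 : 2%:R != 0 :> F := natf_neq0_char0 charF 1.
have I_neq0 : I != 0.
  by apply: contra_eq_neq sqrI => ->; rewrite expr0n eq_sym oppr_eq0 oner_neq0.
have stdP eps := std_map_form n eps two_neq0.
have trP eps := tr_map_form n I eps.
have mulNI_neq0 eps : eps != 0 -> - eps * I != 0.
  by move=> eps_neq0; rewrite mulf_neq0 ?oppr_eq0.
have N1_neq0 : -1 != 0 :> F by rewrite oppr_eq0 oner_neq0.
have irr k : irreducible (action (five_maps n I k)).
  case: k.
  - exact: zero_map_irreducible.
  - exact: conj_form_irreducible (stdP _) n_gt0 (oner_neq0 F).
  - exact: conj_form_irreducible (stdP _) n_gt0 N1_neq0.
  - exact: conj_form_irreducible (trP _) n_gt0 (mulNI_neq0 _ (oner_neq0 F)).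
  exact: conj_form_irreducible (trP _) n_gt0 (mulNI_neq0 _ N1_neq0).
split=> [k|k l kl|V rho [rho_linear rhoP] rho_irr].
- split=> //; case: k.
  + exact: zero_map_representation.
  + by apply: conj_form_representation (stdP _) _; rewrite expr1n.
  + by apply: conj_form_representation (stdP _) _; rewrite sqrrN expr1n.
  + by apply: conj_form_representation (trP _) _; rewrite mulN1r sqrrN.
  by apply: conj_form_representation (trP _) _; rewrite opprK mul1r.
- have at1 m : action (five_maps n I m) 1%:M = five_scalar I m *: \1%VF.
    case: m; first by rewrite /= scale0r.
    - exact: conj_form1 (stdP _).
    - exact: conj_form1 (stdP _).
    - exact: conj_form1 (trP _).
    exact: conj_form1 (trP _).
  move=> /(equivalent_scalar (irr l) (at1 k) (at1 l)).
  by move=> /(five_scalar_inj charF sqrI).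
have [V_neq0 _] := rho_irr; have V_proper := dim_gt0 V_neq0.
pose rl : {linear 'M[F]_n -> end_algType V_proper} :=
  HB.pack (rho : 'M[F]_n -> end_algType V_proper)
    (GRing.isLinear.Build F 'M[F]_n (end_algType V_proper) _ rho rho_linear).
have rlP a b c : rl (triple a b c) = rl a * rl b * rl c - rl c * rl b * rl a.
  exact: rhoP.
have [mu rho1] : exists mu, rho 1%:M = mu *: \1%VF.
  apply: (schur_scalar rho_irr) => a; exact: (rho1_central charF n_gt0 rlP a).
have [mu0|mu_neq0] := eqVneq mu 0.
  exists Zero; apply: (zero_equivalent rho_irr) => a.
  by apply: (rho_eq0 charF n_gt0 rlP _ a); rewrite /= rho1 mu0 scale0r.
have [R [R1 RM]] := scalar_rep_cases charF n_ge2 rlP mu_neq0 rho1.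
case=> -[mu2 rhoE].
  have equiv := multiplicative_equivalent R1 RM (t := false) rhoE _ rho_irr.
  have /orP[/eqP mu1|/eqP mu1] : (mu == 1) || (mu == -1).
  - by rewrite -sqrf_eq1 mu2.
  - by exists StdPlus; apply: equiv (irr StdPlus); rewrite mu1; exact: stdP.
  by exists StdMinus; apply: equiv (irr StdMinus); rewrite mu1; exact: stdP.
have equiv := multiplicative_equivalent R1 RM (t := true) rhoE _ rho_irr.
have /orP[/eqP mu1|/eqP mu1] : (mu == -1 * I) || (mu == - (-1) * I).
- by rewrite mulN1r opprK mul1r orbC -eqf_sqr mu2 sqrI.
- by exists TrPlus; apply: equiv (irr TrPlus); rewrite mu1; exact: trP.
by exists TrMinus; apply: equiv (irr TrMinus); rewrite mu1; exact: trP.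
Qed.
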